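(* Let $[U,\mathcal K]\subseteq[U',\mathcal K']$ be an embedded pair of Helly systems and suppose the Helly number $h[U',\mathcal K']$ of $[U',\mathcal K']$ is finite. Let $K_1,\dots,K_t\in\mathcal K$ be a critical family in $[U,\mathcal K]$ and let $K'_i\in\mathcal K'$ be any relaxation of $K_i$, $i=1,\dots,t$, such that $K'_1\cap\dots\cap K'_t\neq\emptyset$ (i.e., we have a nontrivial relaxation). Let $\mathcal T$ be a branch-and-cut certificate of infeasibility of the system $K_1,\dots,K_t$ with respect to the relaxed system $K'_1,\dots,K'_t$ in $[U',\mathcal K']$, where the certificates on all the leaves are infeasibility certificates in $[U',\mathcal K']$ (including the cutting plane certifiers). Then the certificate $\mathcal T$ has size at least $$\frac{t}{h[U',\mathcal K']-1}.$$ In particular, one can find instances where branch-and-cut infeasibility certificates are of size at least $\frac{h[U,\mathcal K]}{h[U',\mathcal K']-1}$.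
   Context: A Helly system $[U,\mathcal K]$ consists of an arbitrary set $U$ and a family $\mathcal K$ of subsets of $U$ that contains $\emptyset$ and $U$ and is closed under arbitrary intersections. The Helly number $h[U,\mathcal K]$ is the smallest natural number $h$ such that for any finite collection $K_1,\dots,K_t\in\mathcal K$, $K_1\cap\dots\cap K_t=\emptyset$ if and only if there exist $1\le i_1\le\dots\le i_h\le t$ with $K_{i_1}\cap\dots\cap K_{i_h}=\emptyset$ (and $h[U,\mathcal K]=\infty$ if no such number exists). A collection $K_1,\dots,K_t$ is critical if its intersection is empty but every strict subfamily has nonempty intersection; $h[U,\mathcal K]$ is thus the size of the largest critical family. $[U,\mathcal K]$ is embedded in $[U',\mathcal K']$, written $[U,\mathcal K]\subseteq[U',\mathcal K']$, if $U\subseteq U'$ and $\mathcal K=\{K'\cap U:K'\in\mathcal K'\}$. $K'\in\mathcal K'$ is a relaxation of $K\in\mathcal K$ (and $K$ is the restriction of $K'$) if $K=K'\cap U$. A valid disjunction is a finite collection $D_1,\dots,D_p\in\mathcal K'$ with $\bigcup_i(D_i\cap U)=U$. A halfspace in a Helly system is a member of the family whose complement is also in the family. A valid halfspace in $[U',\mathcal K']$ for $K\in\mathcal K$ is a halfspace $H'$ in $[U',\mathcal K']$ with $K\subseteq H'\cap U$. A certificate of infeasibility for a system of sets with empty intersection is a binary string $P$ which, given together with the system $I$ to a fixed checking algorithm, makes it report ''YES'' within $p(|I|+|P|)$ steps for a fixed polynomial $p$; every infeasible system has such a string and no feasible system has one. Its size is its length $|P|$. A branch-and-cut tree for $[U,\mathcal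 K]\subseteq[U',\mathcal K']$ is a rooted tree in which each node has two labels. The first label is a list $\mathcal L$ of sets in $\mathcal K'$. The second label of an internal node with list $\mathcal L$ is either (a) a valid disjunction $D_1,\dots,D_p$, in which case the node has $p$ children with first labels $\mathcal L\cup\{D_i\}$, $i=1,\dots,p$; or (b) a valid halfspace $H'$ in $[U',\mathcal K']$ for $K'\cap U$, where $K'$ is the intersection of all sets in $\mathcal L$, in which case the node has two children: the right child has first label $\mathcal L\cup\{H'\}$, and the left child is a leaf, called a cutting plane certifier, whose second label is a certificate of infeasibility for the system consisting of the restrictions of the sets in $\mathcal L$ together with $H^c=U\setminus H$, where $H=H'\cap U$. The second label of a leaf is a placeholder that can be empty or hold a certificate of infeasibility. The size of the tree is its total number of nodes plus the sum of the sizes of all infeasibility certificates provided at the nodes with valid halfspaces. For $K_1\cap\dots\cap K_t=\emptyset$, a branch-and-cut certificate of infeasibility of $K_1,\dots,K_t$ with respect to $K'_1,\dots,K'_t$ is a branch-and-cut tree whose root has first label $\{K'_1,\dots,K'_t\}$ and in which every leaf either is a cutting plane certifier, or has as first label a list of sets with empty intersection and as second label a certificate of infeasibility of this list in $[U',\mathcal K']$. *)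

(* Defs.v *)
From HB Require Import structures.
From mathcomp Require Import all_boot all_order all_algebra.
From mathcomp Require Import boolp classical_sets.

Set Implicit Arguments.
Unset Strict Implicit.
Unset Printing Implicit Defensive.

Import Order.TTheory GRing.Theory Num.Theory.
Local Open Scope classical_set_scope.

(* The ground sets are subsets of an ambient type, so that U `<=` U' makes
   sense literally for an embedded pair.  The intersection of the empty
   subfamily is the ground set. *)
Record hellySystem (T : Type) := HellySystem {
  ground : set T;
  family : set (set T);
  family_sub : forall A, family A -> A `<=` ground;
  family_set0 : family set0;
  family_ground : family ground;
  family_bigcap : forall F : set (set T), F `<=` family ->
    family (ground `&` \bigcap_(A in F) A)
}.

Section Helly.
Context {T : Type}.
Implicit Types (S : hellySystem T).

Definition interf S (I : Type) (J : set I) (F : I -> set T) : set T :=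
  ground S `&` \bigcap_(i in J) F i.

Definition inters S (L : seq (set T)) : set T :=
  ground S `&` \bigcap_(A in [set` L]) A.

Definition helly_property S (h : nat) : Prop :=
  forall (t : nat) (F : 'I_t -> set T), (forall i, family S (F i)) ->
    (interf S setT F = set0 <->
     exists i : 'I_h -> 'I_t,
       (forall a b : 'I_h, (a <= b)%N -> (i a <= i b)%N) /\
       interf S setT (F \o i) = set0).

Definition helly_number S (h : nat) : Prop :=
  helly_property S h /\ forall k, helly_property S k -> (h <= k)%N.

Definition helly_number_infinite S : Prop := forall k, ~ helly_property S k.

(* Subfamilies are taken by indices, so repeated members count separately. *)
Definition critical S (t : nat) (F : 'I_t -> set T) : Prop :=
  [/\ forall i, family S (F i),
      interf S setT F = set0 &
      forall J : set 'I_t, J `<` setT -> interf S J F !=set0].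

Definition embedded S S' : Prop :=
  ground S `<=` ground S' /\
  family S = [set A `&` ground S | A in family S'].

Definition relaxation S S' (A A' : set T) : Prop :=
  family S' A' /\ A = A' `&` ground S.

Definition nontrivial_relaxation S S' (t : nat) (K K' : 'I_t -> set T) : Prop :=
  (forall i, relaxation S S' (K i) (K' i)) /\ interf S' setT K' !=set0.

Definition valid_disjunction S S' (D : seq (set T)) : Prop :=
  (forall A, A \in D -> family S' A) /\
  \bigcup_(A in [set` D]) (A `&` ground S) = ground S.

Definition halfspace S (H : set T) : Prop :=
  family S H /\ family S (ground S `\` H).

Definition valid_halfspace S S' (A H : set T) : Prop :=
  halfspace S' H /\ A `<=` H `&` ground S.

(* A notion of infeasibility certificate for the finite systems of members of
   S.  No model of computation is singled out: the checking algorithm is an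
   arbitrary deterministic machine (Turing, RAM, BSS and so on) given by its
   configurations, and cs_size is the size |I| of a system I. *)
Record certScheme S := CertScheme {
  cs_size : seq (set T) -> nat;
  cs_state : Type;
  cs_init : seq (set T) -> seq bool -> cs_state;
  cs_step : cs_state -> cs_state;
  cs_yes : cs_state -> bool;
  cs_poly : {poly nat};
  cs_correct : forall I : seq (set T), (forall A, A \in I -> family S A) ->
    (inters S I = set0 <->
     exists (P : seq bool) (n : nat),
       (n <= cs_poly.[(cs_size I + size P)%N]%R)%N /\
       cs_yes (iter n cs_step (cs_init I P)))
}.

Definition infeasibility_certificate S (C : certScheme S)
    (I : seq (set T)) (P : seq bool) : Prop :=
  (forall A, A \in I -> family S A) /\
  exists n : nat, (n <= (cs_poly C).[(cs_size C I + size P)%N]%R)%N /\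
    cs_yes (iter n (@cs_step _ C) (cs_init C I P)).

End Helly.

(* The first argument of each constructor is the first label of the node.
   BCCut L H P r is a node labelled by the halfspace H: its left child is the
   cutting plane certifier with second label P, its right child is r. *)
Inductive bcTree (T : Type) :=
| BCLeaf (L : seq (set T)) (P : option (seq bool))
| BCDisj (L D : seq (set T)) (children : seq (bcTree T))
| BCCut (L : seq (set T)) (H : set T) (P : seq bool) (r : bcTree T).

Section BranchAndCut.
Context {T : Type}.
Implicit Types (S : hellySystem T) (tr : bcTree T).

Definition bc_label tr : seq (set T) :=
  match tr with BCLeaf L _ | BCDisj L _ _ | BCCut L _ _ _ => L end.

(* The summand 2 in the last case counts the node and its left child. *)
Fixpoint bc_nodes tr : nat :=
  match tr with
  | BCLeaf _ _ => 1
  | BCDisj _ _ ch => (sumn (map bc_nodes ch)).+1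
  | BCCut _ _ _ r => 2 + bc_nodes r
  end.

Fixpoint bc_cut_certificates tr : nat :=
  match tr with
  | BCLeaf _ _ => 0
  | BCDisj _ _ ch => sumn (map bc_cut_certificates ch)
  | BCCut _ _ P r => size P + bc_cut_certificates r
  end.

Definition bc_size tr : nat := bc_nodes tr + bc_cut_certificates tr.

(* The cutting plane certifier has to show that no point of U satisfies the
   sets in L and lies in U \ H, where H = H' `&` U.  Its certificate being one
   in [U', K'], it is a certificate for the system made of the sets in L and a
   relaxation C' in K' of U \ H.  The choice C' = U' \ H' is allowed; for
   U = Z^n, U' = R^n and H' = {x | a.x < b + 1} so is C' = {x | b + 1 <= a.x},
   as in Chvatal-Gomory cuts. *)
Definition cut_certificate S S' (C : certScheme S') (L : seq (set T))
    (H' : set T) (P : seq bool) : Prop :=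
  exists2 C' : set T,
    relaxation S S' (ground S `\` (H' `&` ground S)) C' &
    infeasibility_certificate C (rcons L C') P.

Fixpoint bc_tree S S' (C : certScheme S') tr : Prop :=
  (forall A, A \in bc_label tr -> family S' A) /\
  match tr with
  | BCLeaf _ _ => True
  | BCDisj L D ch =>
      [/\ valid_disjunction S S' D,
          [seq bc_label c | c <- ch] = [seq rcons L A | A <- D] &
          foldr (fun c Q => bc_tree S C c /\ Q) True ch]
  | BCCut L H' P r =>
      [/\ valid_halfspace S S' (inters S' L `&` ground S) H',
          cut_certificate S C L H' P,
          bc_label r = rcons L H' &
          bc_tree S C r]
  end.

Fixpoint bc_leaves_certified S' (C : certScheme S') tr : Prop :=
  match tr with
  | BCLeaf L P => inters S' L = set0 /\
      exists2 Q, P = Some Q & infeasibility_certificate C L Q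
  | BCDisj _ _ ch =>
      foldr (fun c Q => bc_leaves_certified C c /\ Q) True ch
  | BCCut _ _ _ r => bc_leaves_certified C r
  end.

Definition bc_certificate S S' (C : certScheme S') (t : nat)
    (K' : 'I_t -> set T) tr : Prop :=
  [/\ bc_tree S C tr, bc_label tr = codom K' & bc_leaves_certified C tr].

End BranchAndCut.

(* Main.v *)
(** Every infeasible leaf system of the tree, cutting plane certifiers included,
    has a subsystem of at most [h'] members with empty intersection, by the Helly
    property of the relaxed system; since [K'_1, ..., K'_t] intersect, at most
    [h' - 1] of these members come from the root.  Let [J] be the set of all root
    indices so used.  A point of [U] lying in [K_j] for every [j] in [J] could be
    followed down the tree (a disjunction covers [U], and a cut separates
    [U] into [H] and its complement) to a leaf whose chosen subsystem it
    satisfies, a contradiction.  As the family is critical, [J] must contain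
    all of the [t] indices. *)

Require Import Defs.
From mathcomp Require Import all_boot all_order all_algebra.
From mathcomp Require Import boolp classical_sets.
Import Order.TTheory GRing.Theory Num.Theory.
Local Open Scope classical_set_scope.
Local Open Scope ring_scope.

(** * Helly numbers and critical families *)

Lemma interf_comp_sub {T : Type} (S : hellySystem T) (I I' : Type)
    (F : I -> set T) (i : I' -> I) :
  interf S setT F `<=` interf S setT (F \o i).
Proof. by move=> x [gx Fx]; split=> // a _; exact: Fx. Qed.

Lemma helly_property0 {T : Type} (S : hellySystem T) :
  ground S = set0 -> helly_property S 0.
Proof.
move=> g0 t F _; rewrite /interf g0 !set0I; split=> // _.
exists (fun a : 'I_0 => match notF (ltn_ord a) with end).
by split=> [[]|]; rewrite ?set0I.
Qed.

Lemma helly_number_ground {T : Type} (S : hellySystem T) (h : nat) :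
  helly_number S h -> (0 < h)%N -> ground S !=set0.
Proof.
move=> [_ hmin] h_gt0; apply/set0P/eqP => g0.
by have := hmin _ (helly_property0 S g0); rewrite leqNgt h_gt0.
Qed.

(** The range of [i] has at most [k < t] elements, so it is a proper subset of the indices. *)
Lemma critical_subfamily {T : Type} (S : hellySystem T) (t k : nat)
    (K : 'I_t -> set T) (i : 'I_k -> 'I_t) :
  critical S K -> (k < t)%N -> interf S setT (K \o i) !=set0.
Proof.
move=> [_ _ crit] lt_kt.
have /crit [x [gx Kx]] : range i `<` setT.
  split=> // ti; suff : (t <= k)%N by rewrite leqNgt lt_kt.
  rewrite -{1}(card_ord t) -(card_ord k); apply: leq_trans (leq_image_card i _).
  apply: subset_leq_card; apply/fintype.subsetP => j _.
  by have [a _ <-] := ti j Logic.I; exact: fintype.image_f.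
by exists x; split=> // a _; apply: Kx; exists a.
Qed.

Lemma critical_leq_helly {T : Type} (S : hellySystem T) (t h : nat)
    (K : 'I_t -> set T) :
  helly_property S h -> critical S K -> (t <= h)%N.
Proof.
move=> hp crit; have [Kf K0 _] := crit; rewrite leqNgt; apply/negP => lt_ht.
have [/(_ K0) [i [_ i0]] _] := hp t K Kf.
by have [x] := critical_subfamily S t h K i crit lt_ht; rewrite i0.
Qed.

(** Serves to choose indices in nondecreasing order, as the Helly property demands. *)
Lemma sorted_enum_ord (t : nat) (A : {set 'I_t}) :
  sorted leq [seq val i | i <- enum A].
Proof.
rewrite sorted_map {1}/enum_mem -enumT; apply: sorted_filter.
  by move=> y x z; exact: leq_trans.
by rewrite -sorted_map val_enum_ord iota_sorted.
Qed.

(** By contraposition: a subfamily of least size with empty intersection is critical. If critical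
    families have at most [k] members, then listing this one, padded to length [k], gives the Helly
    property for [k]. *)
Lemma critical_of_not_helly {T : Type} (S : hellySystem T) (k : nat) :
  ground S !=set0 -> ~ helly_property S k ->
  exists (m : nat) (K : 'I_m -> set T), critical S K /\ (k < m)%N.
Proof.
move=> [x0 gx0] nhp; apply: contrapT => ncrit; apply: nhp => t F Ff.
split; last first.
  by move=> [i [_ i0]]; rewrite -subset0 -i0; exact: interf_comp_sub.
move=> F0.
pose P (J : {set 'I_t}) := `[< interf S [set` J] F = set0 >].
have PT : P finset.setT.
  by apply/asboolP; rewrite -subset0 -F0 => x [gx Fx]; split=> // i _;
    apply: Fx; rewrite /= inE.
case: (arg_minnP (fun J : {set 'I_t} => #|J|) PT) => J /asboolP J0 Jmin.
have critJ : critical S (F \o (@enum_val _ (mem J))).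
  split.
  - by move=> i; exact: Ff.
  - rewrite -subset0 -J0 => x [gx Fx]; split=> // i iJ.
    by have := Fx (enum_rank_in iJ i) Logic.I; rewrite /= enum_rankK_in.
  (* A subfamily of [J] with empty intersection has at least as many members as [J] by minimality,
     hence is all of [J]. *)
  - move=> J' [_ J'T]; apply/set0P/eqP => J'0; apply: J'T => j _.
    pose B : {set 'I_#|J|} := [set j | `[< J' j >]]%SET.
    have /Jmin : P (enum_val @: B)%SET.
      apply/asboolP; rewrite -subset0 -J'0 => x [gx Fx]; split=> // i J'i.
      by apply: Fx; apply: imset_f; rewrite inE; apply/asboolP.
    move=> /leq_trans /(_ (leq_imset_card _ _)) leJB.
    have /setP/(_ j) : B = finset.setT.
      by apply/eqP; rewrite eqEcard finset.subsetT cardsT card_ord.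
    by rewrite !inE => /asboolP.
have le_Jk : (#|J| <= k)%N.
  by rewrite leqNgt; apply/negP => lt_kJ; apply: ncrit; exists #|J|;
    eexists; split; first exact: critJ.
(* The empty subfamily intersects to the ground set, which contains [x0]. So [J] has a member that
   can be repeated as padding. *)
have J_gt0 : (0 < #|J|)%N.
  rewrite lt0n cards_eq0; apply/eqP => Je.
  suff : interf S [set` J] F x0 by rewrite J0.
  by split=> // i; rewrite Je /= inE.
have [j0 j0J] := card_gt0P J_gt0.
have ltJ a : (minn a #|J|.-1 < #|J|)%N.
  by rewrite -[X in (_ < X)%N](prednK J_gt0) ltnS geq_minr.
(* List [J] in increasing order, then repeat its last element. *)
exists (fun a : 'I_k => nth j0 (enum J) (minn a #|J|.-1)); split.
  move=> a b le_ab.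
  have := sorted_leq_nth leq_trans leqnn 0%N (sorted_enum_ord t J).
  move=> /(_ (minn a #|J|.-1) (minn b #|J|.-1)).
  rewrite !inE size_map -!cardE => /(_ (ltJ _) (ltJ _)).
  rewrite !(nth_map j0) -?cardE //; apply.
  by rewrite leq_min geq_minr andbT (leq_trans (geq_minl _ _)).
rewrite -subset0 -J0 => x [gx Fx]; split=> // i iJ.
have iE : (index i (enum J) < #|J|)%N by rewrite cardE index_mem mem_enum.
have ik : (index i (enum J) < k)%N by exact: leq_trans iE le_Jk.
have := Fx (Ordinal ik) Logic.I; rewrite /=.
have -> : minn (index i (enum J)) #|J|.-1 = index i (enum J).
  by apply/minn_idPl; rewrite -ltnS prednK.
by rewrite nth_index ?mem_enum.
Qed.

(** * Root indices used by the leaves of a tree *)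

Lemma infeasibility_certificate_inters {T : Type} (S : hellySystem T)
    (C : certScheme S) (I : seq (set T)) (P : seq bool) :
  infeasibility_certificate C I P -> inters S I = set0.
Proof. by move=> [If [n nP]]; apply/(cs_correct C If); exists P, n. Qed.

(** Supplies induction hypotheses for the trees inside the list [ch], as a [foldr] of the same shape
    as in [bc_tree]. *)
Lemma bcTree_nested_ind (T : Type) (Q : bcTree T -> Prop) :
  (forall L P, Q (BCLeaf L P)) ->
  (forall L D ch, foldr (fun c R => Q c /\ R) True ch -> Q (BCDisj L D ch)) ->
  (forall L H P r, Q r -> Q (BCCut L H P r)) ->
  forall tr, Q tr.
Proof.
move=> Qleaf Qdisj Qcut; fix IH 1; case=> [L P|L D ch|L H P r].
- exact: Qleaf.
- by apply: Qdisj; elim: ch => //= c ch IHch; split.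
- exact: Qcut.
Qed.

Section TreeBound.
Context {T : Type} {S S' : hellySystem T} {C : certScheme S'} {h' t : nat}.
Context {K' : 'I_t -> set T}.
Hypothesis sub_ground : ground S `<=` ground S'.
Hypothesis hp : helly_property S' h'.
Hypothesis K'_meet : interf S' setT K' !=set0.

(* The sets in [E] are those added to the root system on the way to a node. *)
Definition refutes (J : {set 'I_t}) (E : seq (set T)) : Prop :=
  forall x, ground S x -> (forall i, i \in J -> K' i x) ->
    ~ (forall A, A \in E -> A x).

Lemma refutes_sub (J J' : {set 'I_t}) (E : seq (set T)) :
  J \subset J' -> refutes J E -> refutes J' E.
Proof.
by move=> /fintype.subsetP sJJ' rJ x gx J'x; apply: rJ => // i /sJJ' /J'x.
Qed.

Lemma refutes_leaf (E : seq (set T)) :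
  (forall A, A \in codom K' ++ E -> Defs.family S' A) ->
  inters S' (codom K' ++ E) = set0 ->
  exists2 J : {set 'I_t}, (#|J| <= h'.-1)%N & refutes J E.
Proof.
move=> Lf L0; set L := codom K' ++ E in Lf L0.
pose F (i : 'I_(size L)) := nth set0 L i.
have F0 : interf S' setT F = set0.
  rewrite -subset0 -L0 => x [gx Fx]; split=> // A /= AL.
  have iA : (index A L < size L)%N by rewrite index_mem.
  by have := Fx (Ordinal iA) Logic.I; rewrite /F /= nth_index.
have Ff i : Defs.family S' (F i) by apply: Lf; exact: mem_nth.
have [/(_ F0) [i [_ i0]] _] := hp _ F Ff.
pose root : {set 'I_h'} := [set a | (i a < t)%N]%SET.
have nthK (j : 'I_t) : nth set0 (codom K') j = K' j.
  by rewrite codomE (nth_map j) ?size_enum_ord // nth_ord_enum.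
have FK (a : 'I_h') (lt_it : (i a < t)%N) : F (i a) = K' (Ordinal lt_it).
  rewrite /F /L nth_cat size_codom card_ord lt_it.
  exact: nthK (Ordinal lt_it).
pose toK (a : 'I_h') : option 'I_t := insub (val (i a)).
pose J : {set 'I_t} := [set j in pmap toK (enum root)]%SET.
exists J.
  (* If all [h'] chosen sets came from the root, a common point of the [K'] would lie in their empty
     intersection. *)
  have ltr : (#|root| < h')%N.
    rewrite ltnNge; apply/negP => le_hr.
    have rT : root = finset.setT.
      by apply/eqP; rewrite eqEcard finset.subsetT cardsT card_ord.
    have [y [gy K'y]] := K'_meet.
    suff : interf S' setT (F \o i) y by rewrite i0.
    split=> // a _; have /setP/(_ a) := rT; rewrite !inE => lt_it.
    by rewrite /= (FK a lt_it); exact: K'y.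
  rewrite -ltnS (ltn_predK ltr); apply: leq_ltn_trans ltr.
  rewrite cardsE (leq_trans (card_size _)) // size_pmap [leqRHS]cardE.
  exact: count_size.
move=> x gx Jx Ex; suff : interf S' setT (F \o i) x by rewrite i0.
split; first exact: sub_ground.
move=> a _ /=; have [lt_it|le_ti] := ltnP (i a) t.
  rewrite (FK a lt_it); apply: Jx; rewrite inE mem_pmap; apply/mapP; exists a.
    by rewrite mem_enum inE.
  by rewrite /toK insubT.
apply: Ex; rewrite /F /L nth_cat size_codom card_ord ltnNge le_ti /=.
apply: mem_nth; rewrite ltn_subLR //.
by have := ltn_ord (i a); rewrite [X in (_ < X)%N]size_cat size_codom card_ord.
Qed.

(** The index sets of the children are united, each leaf contributing at most [h'.-1] indices. *)
Lemma refutes_tree (tr : bcTree T) (E : seq (set T)) :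
  bc_tree S C tr -> bc_leaves_certified C tr ->
  bc_label tr = codom K' ++ E ->
  exists2 J : {set 'I_t}, (#|J| <= h'.-1 * bc_nodes tr)%N & refutes J E.
Proof.
elim/bcTree_nested_ind: tr E => [L P|L D ch IH|L H P r IH] E /=.
- move=> [Lf _] [L0 _] LE; rewrite muln1; apply: refutes_leaf; rewrite -?LE //.
- move=> [Lf [[Df Dcover] Dch cht]] chc LE.
  have {Dcover} cover x : ground S x -> exists2 A, A \in D & A x.
    by rewrite -Dcover => -[A /= AD [Ax _]]; exists A.
  (* A point of [U] lies in some disjunct, so a [J] that works for every child works for the
     node. *)
  suff [J cJ rJ] : exists2 J : {set 'I_t},
      (#|J| <= h'.-1 * sumn (map bc_nodes ch))%N &
      forall A, A \in D -> refutes J (rcons E A).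
    exists J; first by rewrite (leq_trans cJ) // leq_mul2l leqnSn orbT.
    move=> x gx Jx Ex; have [A AD Ax] := cover x gx.
    by apply: (rJ A AD x) => // B; rewrite mem_rcons inE => /predU1P[->|/Ex].
  elim: ch D Dch {Df cover} IH cht chc => [|c ch IHch] [|A D] //=.
    by move=> *; exists finset.set0; rewrite ?cards0.
  move=> [cA Dch] [IHc IH] [ct cht] [cc chc].
  have [J cJ rJ] := IHch D Dch IH cht chc.
  have [|Jc cJc rJc] := IHc (rcons E A) ct cc.
    by rewrite cA LE rcons_cat.
  exists (Jc :|: J)%SET.
    by rewrite (leq_trans (leq_card_setU _ _)) // mulnDr leq_add.
  move=> B; rewrite inE => /predU1P[->|/rJ].
    exact: refutes_sub (finset.subsetUl _ _) rJc.
  exact: refutes_sub (finset.subsetUr _ _).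
- move=> [Lf [_ [C' [C'f HC'] cert] rL rt]] rc LE.
  have [|J cJ rJ] := IH (rcons E H) rt rc; first by rewrite rL LE rcons_cat.
  have [||Jc cJc rJc] := refutes_leaf (rcons E C').
  + by rewrite -rcons_cat -LE; case: cert.
  + by rewrite -rcons_cat -LE; exact: infeasibility_certificate_inters cert.
  exists (Jc :|: J)%SET.
    rewrite (leq_trans (leq_card_setU _ _)) // mulnDr leq_add //.
    by rewrite (leq_trans cJc) // leq_pmulr.
  (* A point in [H] goes to the right child; any other point of [U] lies in [C'], the relaxation of
     the complement, and goes to the certifier. *)
  move=> x gx JJx Ex; have [Hx|nHx] := pselect (H x).
    apply: (rJ x gx) => [i iJ|B]; first by apply: JJx; rewrite inE iJ orbT.
    by rewrite mem_rcons inE => /predU1P[->|/Ex].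
  have [C'x _] : (C' `&` ground S) x by rewrite -HC'; split=> // -[].
  apply: (rJc x gx) => [i iJ|B]; first by apply: JJx; rewrite inE iJ.
  by rewrite mem_rcons inE => /predU1P[->|/Ex].
Qed.

End TreeBound.

(** * Size bounds and existence of nontrivial relaxations *)

Lemma critical_leq_nodes {T : Type} (S S' : hellySystem T) (C : certScheme S')
    (h' t : nat) (K K' : 'I_t -> set T) (tr : bcTree T) :
  embedded S S' -> helly_property S' h' -> critical S K ->
  nontrivial_relaxation S S' K K' -> bc_certificate S C K' tr ->
  (t <= h'.-1 * bc_nodes tr)%N.
Proof.
move=> [sub_ground _] hp [_ _ crit] [relK meet] [trt trL trc].
have [|J cJ rJ] := refutes_tree sub_ground hp meet tr [::] trt trc.
  by rewrite cats0.
apply: leq_trans cJ; rewrite leqNgt; apply/negP => ltJ.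
have /crit [x [gx Kx]] : [set` J] `<` setT.
  split=> // sJ; move: ltJ; rewrite ltnNge -{1}(card_ord t).
  by rewrite subset_leq_card //; apply/fintype.subsetP => i _; exact: sJ.
apply: (rJ x gx) => // i iJ; have := Kx i iJ.
by have [_ ->] := relK i; case.
Qed.

(** The root is no leaf, since the [K'] meet, and no empty disjunction covers a nonempty [U]. *)
Lemma bc_certificate_two_nodes {T : Type} (S S' : hellySystem T)
    (C : certScheme S') (t : nat) (K' : 'I_t -> set T) (tr : bcTree T) :
  ground S !=set0 -> interf S' setT K' !=set0 -> bc_certificate S C K' tr ->
  (1 < bc_nodes tr)%N.
Proof.
move=> [x gx] [y [gy K'y]]; case: tr => [L P|L D ch|L H P r] [/=].
- move=> _ -> [L0 _]; suff : inters S' (codom K') y by rewrite L0.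
  by split=> // A /= /codomP[i ->]; exact: K'y.
- case: ch => [|c ch] [_ [[_ Dg] Dch _]] _ _ /=.
    by case: D Dg Dch => // Dg _; move: gx; rewrite -Dg => -[A].
  by rewrite ltnS addn_gt0; case: (c).
- by [].
Qed.

(** Were the relaxations to have empty intersection, some [h'] of them would too, and so would their
    restrictions, fewer than [t] members of a critical family. *)
Lemma critical_nontrivial_relaxation {T : Type} (S S' : hellySystem T)
    (h' t : nat) (K : 'I_t -> set T) :
  embedded S S' -> helly_property S' h' -> critical S K -> (h' < t)%N ->
  exists K' : 'I_t -> set T, nontrivial_relaxation S S' K K'.
Proof.
move=> [sub_ground famE] hp crit lt_ht; have [Kf _ _] := crit.
have /choice [K' relK] (i : 'I_t) : exists A', relaxation S S' (K i) A'.
  by have := Kf i; rewrite famE => -[A' A'f <-]; exists A'.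
exists K'; split=> //; apply/set0P/eqP => K'0.
have [/(_ K'0) [i [_ i0]] _] := hp t K' (fun i => (relK i).1).
have [x [gx Kx]] := critical_subfamily S t h' K i crit lt_ht.
suff : interf S' setT (K' \o i) x by rewrite i0.
split=> [|a _]; first exact: sub_ground.
by have := Kx a Logic.I; rewrite /= (relK (i a)).2 => -[].
Qed.

(* The quotient is [- t] for [h' = 0], and the junk value [t / 0 = 0] for
   [h' = 1]. *)
Lemma ratio_le (t h' n : nat) :
  ((1 < h')%N -> (t <= h'.-1 * n)%N) -> t%:R / (h'%:R - 1) <= n%:R :> rat.
Proof.
case: h' => [|[|h]] le_tn.
- by rewrite sub0r invrN invr1 mulrN1 (le_trans _ (ler0n _ n)) // oppr_le0.
- by rewrite subrr invr0 mulr0.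
- rewrite -[h.+2%:R]natr1 addrK ler_pdivrMr ?ltr0n // -natrM ler_nat.
  by rewrite mulnC; exact: le_tn.
Qed.

Theorem theorem3p1 (T : Type) (S S' : hellySystem T) (C : certScheme S')
    (h' : nat) (hemb : embedded S S') (hh' : helly_number S' h') :
  (forall (t : nat) (K K' : 'I_t -> set T),
     critical S K -> nontrivial_relaxation S S' K K' ->
     forall tr : bcTree T, bc_certificate S C K' tr ->
       (t%:R / (h'%:R - 1) <= (bc_size tr)%:R :> rat))
  /\
  (forall h : nat, helly_number S h ->
     (h' < h)%N \/
     (exists (t : nat) (K K' : 'I_t -> set T),
        critical S K /\ nontrivial_relaxation S S' K K') ->
     exists (t : nat) (K K' : 'I_t -> set T),
       [/\ critical S K, nontrivial_relaxation S S' K K' &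
           forall tr : bcTree T, bc_certificate S C K' tr ->
             (h%:R / (h'%:R - 1) <= (bc_size tr)%:R :> rat)])
  /\
  (helly_number_infinite S -> forall N : nat,
     exists (t : nat) (K K' : 'I_t -> set T),
       [/\ critical S K, nontrivial_relaxation S S' K K' &
           forall tr : bcTree T, bc_certificate S C K' tr ->
             (N <= bc_size tr)%N]).
Proof.
have [hp' _] := hh'.
have bound t (K K' : 'I_t -> set T) (tr : bcTree T) :
    critical S K -> nontrivial_relaxation S S' K K' ->
    bc_certificate S C K' tr -> (t <= h'.-1 * bc_size tr)%N.
  move=> crit rel cert.
  have := critical_leq_nodes S S' C h' t K K' tr hemb hp' crit rel cert.
  by move=> /leq_trans -> //; rewrite leq_mul2l leq_addr orbT.
split.
  move=> t K K' crit rel tr cert; apply: ratio_le => _.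
  exact: bound crit rel cert.
split=> [h hh|inf N].
  have [lt_h _|le_h [//|[t [K [K' [crit rel]]]]]] := ltnP h' h.
  - have g0 := helly_number_ground S h hh (leq_ltn_trans (leq0n _) lt_h).
    have [hp hmin] := hh.
    (* By minimality of [h], the Helly property fails for [h.-1]; this yields a critical family of
       exactly [h] members. *)
    have [|m [K [crit lt_m]]] := critical_of_not_helly S h.-1 g0.
      by move=> /hmin; rewrite leqNgt; case: (h) lt_h => // n _; rewrite ltnSn.
    have mh : m = h.
      apply/eqP; rewrite eqn_leq (critical_leq_helly S m h K hp crit) /=.
      by case: (h) lt_h lt_m.
    rewrite mh in K crit lt_m.
    have [K' rel] :=
      critical_nontrivial_relaxation S S' h' h K hemb hp' crit lt_h.
    exists h, K, K'; split=> // tr cert.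
    by apply: ratio_le => _; exact: bound crit rel cert.
  - exists t, K, K'; split=> // tr cert; apply: ratio_le => h'_gt1.
    (* As [h <= h' <= 2 * (h' - 1)], it suffices that the tree has two nodes. *)
    case: h hh le_h => // h hh le_h.
    have g0 := helly_number_ground S _ hh (ltn0Sn _).
    have two := bc_certificate_two_nodes S S' C t K' tr g0 rel.2 cert.
    have {}two := leq_trans two (leq_addr (bc_cut_certificates tr) _).
    rewrite (leq_trans le_h) // (@leq_trans (h'.-1 * 2)) //; last first.
      by rewrite leq_mul2l two orbT.
    by rewrite muln2 -addnn -[leqLHS](ltn_predK h'_gt1) -addn1 leq_add2l -ltnS
      (ltn_predK h'_gt1).
have g0 : ground S !=set0.
  by apply/set0P/eqP => g0; exact: (inf 0%N) (helly_property0 S g0).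
(* The summand [N * h'.-1] forces a size above [N]; the summand [h'] makes the relaxation
   nontrivial. *)
have [m [K [crit lt_m]]] := critical_of_not_helly S (N * h'.-1 + h') g0 (inf _).
have lt_hm : (h' < m)%N by rewrite (leq_ltn_trans (leq_addl _ _) lt_m).
have [K' rel] := critical_nontrivial_relaxation S S' h' m K hemb hp' crit lt_hm.
exists m, K, K'; split=> // tr /(bound _ _ _ _ crit rel) le_m.
have := leq_trans (leq_ltn_trans (leq_addr _ _) lt_m) le_m.
by rewrite mulnC ltn_mul2l => /andP[_ /ltnW].
Qed.
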